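(* Let $n\equiv 0 \pmod 4$ with $n\ge 8$, and suppose there exists a reverse Gray code for the permutations of $\{1,\ldots,n-3\}$. Then there exists a reverse Gray code $\pi_0,\ldots,\pi_{n!-1}$ for the permutations of $\{1,\ldots,n\}$ with property $P$.
   Context: A reverse Gray code for the permutations of $\{1,\ldots,m\}$ is a listing $\pi_0,\ldots,\pi_{m!-1}$ of all permutations of $\{1,\ldots,m\}$ written as words, such that consecutive permutations differ by interchanging the symbols in two adjacent positions, and $\pi_{i+m!/2}$ is the reversal of $\pi_i$ (the word read backwards) for all $0\le i<m!/2$. Such a code has property $P$ if $\pi_0=12\cdots m$ (so $\pi_{m!/2}=m(m-1)\cdots 21$) and the four permutations immediately preceding $\pi_{m!/2}$ are, in order, $\pi_{m!/2-4}=(m-1)(m-2)(m-3)\,m\,(m-4)\cdots 3\,1\,2$, $\pi_{m!/2-3}=(m-1)(m-2)\,m\,(m-3)(m-4)\cdots 3\,1\,2$, $\pi_{m!/2-2}=(m-1)\,m\,(m-2)(m-3)(m-4)\cdots 3\,1\,2$, $\pi_{m!/2-1}=m(m-1)(m-2)(m-3)(m-4)\cdots 3\,1\,2$; i.e. the symbols $1,\ldots,m-1$ appear in the order $(m-1)(m-2)\cdots 3\,1\,2$ and the symbol $m$ moves from the fourth position to the first. *)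

(* Defs.v *)
From mathcomp Require Import all_boot.
Set Implicit Arguments. Unset Strict Implicit. Unset Printing Implicit Defensive.

Definition adj_transp (p q : seq nat) : Prop :=
  exists i, i.+1 < size p /\
    q = set_nth 0 (set_nth 0 p i (nth 0 p i.+1)) i.+1 (nth 0 p i).

Definition reverse_gray_code (m : nat) (L : seq (seq nat)) : Prop :=
  [/\ size L = m`!,
      uniq L,
      all (fun p => perm_eq p (iota 1 m)) L,
      (forall i, i.+1 < size L -> adj_transp (nth [::] L i) (nth [::] L i.+1))
    & (forall i, i < m`! %/ 2 ->
         nth [::] L (i + m`! %/ 2) = rev (nth [::] L i))].

Definition insert_at (k : nat) (x : nat) (s : seq nat) : seq nat :=
  take k s ++ x :: drop k s.

Definition base_word (m : nat) : seq nat := rev (iota 3 (m - 3)) ++ [:: 1; 2].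

Definition propP (m : nat) (L : seq (seq nat)) : Prop :=
  [/\ nth [::] L 0 = iota 1 m,
      nth [::] L (m`! %/ 2 - 4) = insert_at 3 m (base_word m),
      nth [::] L (m`! %/ 2 - 3) = insert_at 2 m (base_word m),
      nth [::] L (m`! %/ 2 - 2) = insert_at 1 m (base_word m)
    & nth [::] L (m`! %/ 2 - 1) = insert_at 0 m (base_word m)].

Example base_word_8 : base_word 8 = [:: 7; 6; 5; 4; 3; 1; 2]. Proof. by []. Qed.
Example ins_8 : insert_at 3 8 (base_word 8) = [:: 7; 6; 5; 8; 4; 3; 1; 2]. Proof. by []. Qed.

(* Main.v *)
From mathcomp Require Import all_boot zify.
Require Import Defs.
Set Implicit Arguments. Unset Strict Implicit. Unset Printing Implicit Defensive.

(** Let [m = n - 3] and let [s] run through the first half of the given code,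
    relabelled so that it starts with [3 4 ... n-1].  The words obtained from
    [s] by inserting the letters [n], [2], [1] everywhere form the fibre of [s].
    Two neighbouring fibres are joined at a "corner", a word in which [s] is
    contiguous; writing [xy|z] for the corner [x y s z], each fibre has
    Hamiltonian paths (for [m] odd)
      [xyz| -> xy|z],  [xy|z -> x|yz],  [xy|z -> yx|z],
    the first two being boustrophedons and the third a Hamiltonian cycle (a comb)
    with one edge removed.  Together with their inverses and mirror images they
    yield the walk of corners
      [xyz|, xy|z, yx|z, y|xz, y|zx, yz|x, zy|x, z|yx, |zyx],
    which can be prolonged by any even number of swaps [xy|z <-> yx|z], hence
    fitted to the even number [m! / 2] of fibres.  As [|zyx] mirrors [xyz|], the
    resulting path closes up to a reverse Gray code.  Its first row moves [n]
    through [2 1 3 ... n-1], and the next word is [1 2 ... n]; starting the code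
    there gives property [P]. *)

(** * Adjacent transpositions as a decidable symmetric relation *)

Fixpoint adj (p q : seq nat) : bool :=
  match p, q with
  | x :: p1, y :: q1 =>
      (x == y) && adj p1 q1
      || match p1, q1 with
         | x' :: p2, y' :: q2 => [&& x == y', x' == y & p2 == q2]
         | _, _ => false
         end
  | _, _ => false
  end.

Lemma adjP p q :
  reflect (exists u x y v, p = u ++ x :: y :: v /\ q = u ++ y :: x :: v)
          (adj p q).
Proof.
apply: (iffP idP).
  elim: p q => [|x p IH] [|y q] //= /orP[/andP[/eqP<- /IH]|].
    by case=> u [z [t [v [-> ->]]]]; exists (x :: u), z, t, v.
  case: p q {IH} => [|x' p] [|y' q] // /and3P[/eqP<- /eqP<- /eqP<-].
  by exists [::], x, x', p.
case=> u [x [y [v [-> ->]]]]; elim: u => [|z u IH] /=.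
  by rewrite !eqxx orbT.
by rewrite eqxx IH.
Qed.

Lemma adj_transpP p q : reflect (adj_transp p q) (adj p q).
Proof.
apply: (iffP (adjP p q)).
  case=> u [x [y [v [-> ->]]]]; exists (size u); split.
    by rewrite size_cat /=; lia.
  elim: u => [|z u IH] //=.
  by rewrite {1}IH.
case=> i [lti ->]; exists (take i p), (nth 0 p i), (nth 0 p i.+1), (drop i.+2 p).
rewrite -!drop_nth ?cat_take_drop ?(ltnW lti) //; split=> //.
elim: i p lti => [|i IH] [|x p] //= lti; last by rewrite IH.
by case: p lti => //= y p _; rewrite drop0.
Qed.

Lemma adj_sym : symmetric adj.
Proof.
by move=> p q; apply/adjP/adjP=> -[u [x [y [v [-> ->]]]]]; exists u, y, x, v.
Qed.

Lemma adj_cat l r p q : adj p q -> adj (l ++ p ++ r) (l ++ q ++ r).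
Proof.
case/adjP=> u [x [y [v [-> ->]]]]; apply/adjP.
by exists (l ++ u), x, y, (v ++ r); rewrite -!catA.
Qed.

Lemma adj_rcons x p q : adj p q -> adj (rcons p x) (rcons q x).
Proof. by move/(adj_cat [::] [:: x]); rewrite /= !cats1. Qed.

Lemma adj_cons x p q : adj p q -> adj (x :: p) (x :: q).
Proof. by move=> /= ->; rewrite eqxx. Qed.

Lemma adj_rev p q : adj p q -> adj (rev p) (rev q).
Proof.
case/adjP=> u [x [y [v [-> ->]]]]; apply/adjP; exists (rev v), y, x, (rev u).
by rewrite !rev_cat !rev_cons -!cats1 -!catA.
Qed.

Lemma adj_map f p q : adj p q -> adj (map f p) (map f q).
Proof.
case/adjP=> u [x [y [v [-> ->]]]]; apply/adjP.
by exists (map f u), (f x), (f y), (map f v); rewrite !map_cat.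
Qed.

Lemma homo_sorted_map (T T' : Type) (e : rel T) (e' : rel T') (f : T -> T') s :
  {homo f : x y / e x y >-> e' x y} -> sorted e s -> sorted e' (map f s).
Proof. by move=> hf; apply: homo_sorted. Qed.

Lemma sorted_rev_sym (T : Type) (e : rel T) s :
  symmetric e -> sorted e (rev s) = sorted e s.
Proof. by move=> se; rewrite rev_sorted; apply: eq_sorted => x y; rewrite se. Qed.

(** * Rows: one letter moving through a word from left to right *)

Fixpoint row (c : nat) (w : seq nat) : seq (seq nat) :=
  (c :: w) :: (if w is x :: w' then map (cons x) (row c w') else [::]).

Lemma size_row c w : size (row c w) = (size w).+1.
Proof. by elim: w => //= x w IH; rewrite size_map IH. Qed.

Lemma head_row c w : head [::] (row c w) = c :: w.
Proof. by case: w. Qed.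

Lemma last_row p c w : last p (row c w) = rcons w c.
Proof.
elim: w p => //= x w IH p; case: (row c w) IH (size_row c w) => //= q r IH _.
by rewrite last_map (IH [::]).
Qed.

Lemma nth_row c w k : k <= size w -> nth [::] (row c w) k = insert_at k c w.
Proof.
elim: w k => [|x w IH] [|k] //= lek.
by rewrite (nth_map [::]) ?size_row // IH.
Qed.

Lemma sorted_row c w : sorted adj (row c w).
Proof.
elim: w => //= x w IH.
have := homo_sorted_map (@adj_cons x) IH.
by case: w {IH} => [|y w] /= h; rewrite !eqxx /= ?orbT.
Qed.

Lemma mem_rowP c w v :
  reflect (exists u t, w = u ++ t /\ v = u ++ c :: t) (v \in row c w).
Proof.
apply: (iffP idP).
  elim: w v => [|x w IH] v /=; first by rewrite inE => /eqP->; exists [::], [::].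
  rewrite inE => /orP[/eqP->|]; first by exists [::], (x :: w).
  by case/mapP=> v' /IH[u [t [-> ->]]] ->; exists (x :: u), t.
case=> u [t [-> ->]]; elim: u => [|x u IH] /=; first by case: t => *; rewrite /= inE eqxx.
by rewrite inE map_f ?orbT.
Qed.

Lemma perm_row c w v : v \in row c w -> perm_eq v (c :: w).
Proof. by case/mem_rowP=> u [t [-> ->]]; rewrite perm_catC /= perm_cons perm_catC. Qed.

Lemma filter_row c w v : c \notin w -> v \in row c w -> filter (predC1 c) v = w.
Proof.
move=> cw /mem_rowP[u [t [ew ->]]]; rewrite filter_cat /= eqxx -filter_cat -ew.
by apply/all_filterP/allP=> x xw /=; apply: contraNneq cw => <-.
Qed.

Lemma uniq_row c w : c \notin w -> uniq (row c w).
Proof.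
elim: w => //= x w IH; rewrite inE negb_or => /andP[cx cw].
rewrite map_inj_uniq ?IH // => [|u v []//]; rewrite andbT.
by apply/mapP=> -[v _ [/eqP]]; rewrite (negPf cx).
Qed.

(** Deleting [c] from a word of a row recovers the word the row was built on, so distinct words have
    disjoint rows. *)
Lemma uniq_rows c (W : seq (seq nat)) : uniq W -> (forall w, w \in W -> c \notin w) ->
  uniq (flatten (map (row c) W)).
Proof.
elim: W => //= w W IH /andP[wW uW] cW.
rewrite cat_uniq uniq_row ?cW ?mem_head //= IH // ?andbT; last first.
  by move=> v vW; apply: cW; rewrite inE vW orbT.
apply/hasPn=> v /flatten_mapP[w' w'W vw']; apply: contra wW => vw.
have cw' : c \notin w' by rewrite cW // inE w'W orbT.
by rewrite -(filter_row _ vw) ?cW ?mem_head // (filter_row cw' vw').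
Qed.

(** * Paths whose links are governed alternately by two relations *)

Section AlternatingPaths.
Variable T : Type.

(** Rows of a boustrophedon are joined alternately at their right and left ends, and the two kinds
    of joint impose different conditions; the flag [d] says which one comes next. *)
Fixpoint altpath (e : bool -> rel T) d x s :=
  if s is y :: s' then e d x y && altpath e (~~ d) y s' else true.

Lemma altpath_const e d x s : altpath (fun=> e) d x s = path e x s.
Proof. by elim: s d x => //= y s IH d x; rewrite IH. Qed.

Lemma altpath_cat e d x s t :
  altpath e d x (s ++ t)
    = altpath e d x s && altpath e (d (+) odd (size s)) (last x s) t.
Proof.
elim: s d x => [|y s IH] d x /=; first by rewrite addbF.
by rewrite IH andbA addNb addbN.
Qed.

Lemma last_rev_belast (x : T) s z : last z (rev (x :: s)) = x.
Proof. by rewrite rev_cons last_rcons. Qed.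

Lemma rev_lastI (x : T) s : rev (x :: s) = last x s :: rev (belast x s).
Proof. by rewrite lastI rev_rcons. Qed.

(** The first link of the reversed path is the last of the original one, hence the shift of the flag
    by [size s - 1] modulo 2. *)
Lemma altpath_rev e d x s : (forall d, symmetric (e d)) -> altpath e d x s ->
  altpath e (d (+) ~~ odd (size s)) (last x s) (rev (belast x s)).
Proof.
move=> se; elim: s d x => //= y s IH d x /andP[exy /IH ps].
rewrite rev_cons -cats1 altpath_cat /= size_rev size_belast.
have -> : d (+) ~~ ~~ odd (size s) = ~~ d (+) ~~ odd (size s)
  by rewrite negbK addNb addbN negbK.
rewrite ps /= andbT.
have := last_rev_belast y s y; rewrite rev_lastI /= => ->.
have -> : ~~ d (+) ~~ odd (size s) (+) odd (size s) = d
  by rewrite addNb addbN negbK addbK.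
by rewrite se.
Qed.

Definition altsorted (e : bool -> rel T) d s :=
  if s is x :: s' then altpath e d x s' else true.

Lemma altsorted_const e d s : altsorted (fun=> e) d s = sorted e s.
Proof. by case: s => //= x s; rewrite altpath_const. Qed.

Lemma altsorted_eq e d d' s :
  e d = e d' -> e (~~ d) = e (~~ d') -> altsorted e d s = altsorted e d' s.
Proof.
case: s => //= x s; elim: s d d' x => //= y s IH d d' x ed end_.
by rewrite ed (IH (~~ d) (~~ d')) ?negbK.
Qed.

Lemma altsorted_rev e d s : (forall d, symmetric (e d)) ->
  altsorted e d s -> altsorted e (d (+) odd (size s)) (rev s).
Proof.
case: s => // x s se ps; rewrite rev_lastI /=.
exact: altpath_rev.
Qed.

Lemma altsorted_cat x0 e d s t : 0 < size s -> 0 < size t ->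
  altsorted e d (s ++ t) =
    [&& altsorted e d s, e (d (+) odd (size s).-1) (last x0 s) (head x0 t)
      & altsorted e (d (+) odd (size s)) t].
Proof.
case: s t => [|x s] [|y t] // _ _.
by rewrite cat_cons /= altpath_cat /= addbN.
Qed.

End AlternatingPaths.

Lemma altsorted_map (T T' : Type) (e : bool -> rel T) (e' : bool -> rel T')
  (f : T -> T') d s :
  (forall d, {homo f : x y / e d x y >-> e' d x y}) ->
  altsorted e d s -> altsorted e' d (map f s).
Proof.
move=> fe; case: s => //= x s; elim: s d x => //= y s IH d x /andP[/fe-> /IH].
exact.
Qed.

(** * Boustrophedons *)

Section Zigzag.
Variables (T U : eqType) (x0 : T) (f : U -> seq T).

Fixpoint zig (d : bool) (R : seq (seq T)) : seq T :=
  if R is r :: R' then (if d then r else rev r) ++ zig (~~ d) R' else [::].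

Lemma perm_zig d R : perm_eq (zig d R) (flatten R).
Proof.
elim: R d => //= r R IH d; apply: perm_cat (IH _).
by case: d => //; rewrite perm_rev.
Qed.

(* In a left-to-right row ([d = true]) the next row is entered at its last
   element, in a right-to-left row at its first one. *)
Definition rung (e : bool -> rel T) d u u' :=
  if d then e d (last x0 (f u)) (last x0 (f u'))
  else e d (head x0 (f u)) (head x0 (f u')).

Lemma head_rev s : head x0 (rev s) = last x0 s.
Proof. by elim/last_ind: s => // s x _; rewrite rev_rcons last_rcons. Qed.

Lemma last_rev s : last x0 (rev s) = head x0 s.
Proof. by rewrite -head_rev revK. Qed.

Lemma size_zig d u W : 0 < size (f u) -> 0 < size (zig d (map f (u :: W))).
Proof. by move=> fu; rewrite (perm_size (perm_zig _ _)) size_cat ltn_addr. Qed.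

Lemma head_zig d u W : 0 < size (f u) ->
  head x0 (zig d (map f (u :: W))) = if d then head x0 (f u) else last x0 (f u).
Proof.
move=> fu; rewrite /=; case: d; first by case: (f u) fu.
by rewrite -head_rev; case: (rev _) (size_rev (f u)) fu => //= <-.
Qed.

Lemma last_zig d u W : {in u :: W, forall v, 0 < size (f v)} ->
  last x0 (zig d (map f (u :: W))) =
    if d (+) odd (size W) then last x0 (f (last u W)) else head x0 (f (last u W)).
Proof.
elim: W d u => [|w W IH] d u fW.
  by rewrite /= cats0 addbF; case: d => //; rewrite last_rev.
rewrite (_ : zig d _ = (if d then f u else rev (f u)) ++ zig (~~ d) (map f (w :: W))) //.
have fw : 0 < size (zig (~~ d) (map f (w :: W))).
  by apply: size_zig; rewrite fW // !inE eqxx orbT.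
rewrite last_cat (_ : last _ _ = last x0 (zig (~~ d) (map f (w :: W)))); last first.
  by case: (zig _ _) fw.
rewrite IH => [|v vW]; last by rewrite fW // inE vW orbT.
by rewrite /= addbN addNb.
Qed.

(** The third hypothesis covers two uses at once: either every row has odd length, and then the flag
    at the start of a row agrees with its direction, or [e] is constant and flags do not matter. *)
Lemma altsorted_zig e d u W :
  {in u :: W, forall v, 0 < size (f v)} ->
  {in u :: W, forall v d, altsorted e d (if d then f v else rev (f v))} ->
  {in u :: W, forall v d, e (d (+) odd (size (f v))) = e (~~ d)} ->
  altpath (rung e) d u W ->
  altsorted e d (zig d (map f (u :: W))).
Proof.
elim: W d u => [|w W IH] d u f0 fe fp.
  by rewrite /= cats0 => _; apply: fe; rewrite mem_head.
case/andP=> uw wW.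
have uuW : u \in u :: w :: W by rewrite mem_head.
have sub v : v \in w :: W -> v \in u :: w :: W by move=> h; rewrite in_cons h orbT.
have f1 : {in w :: W, forall v, 0 < size (f v)} by move=> v /sub /f0.
rewrite (_ : zig d _ = (if d then f u else rev (f u)) ++ zig (~~ d) (map f (w :: W))) //.
have sz : size (if d then f u else rev (f u)) = size (f u).
  by case: d {uw wW} => //; rewrite size_rev.
rewrite (altsorted_cat x0) ?sz ?f0 ?size_zig ?f1 ?mem_head //.
rewrite fe // head_zig ?f1 ?mem_head //.
have -> : e (d (+) odd (size (f u)).-1) = e d.
  have := fp u uuW (~~ d); rewrite negbK => <-.
  by have := f0 u uuW; case: (size _) => //= k _; rewrite addbN addNb negbK.
rewrite (@altsorted_eq _ _ _ (~~ d)) ?fp // ?negbK; last first.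
  have := fp u uuW (~~ d); rewrite negbK => <-.
  by rewrite addNb.
rewrite (IH (~~ d) w) ?andbT //; last 2 first.
- by move=> v /sub /fe.
- by move=> v /sub /fp.
by move: uw; rewrite /rung; case: d {wW sz} => //=; rewrite last_rev.
Qed.

End Zigzag.

(** * Fibres: all ways to insert given letters into a word *)

(** Exhaustiveness is expressed by counting: distinctness and the length [k] are exactly what the
    final code has to satisfy. The filter condition keeps different fibres disjoint. *)
Definition fibre (A s : seq nat) (k : nat) (P : seq (seq nat)) :=
  [/\ uniq P, size P = k &
    {in P, forall v, perm_eq v (A ++ s) /\ filter (predC (mem A)) v = s}].

Lemma fibre_perm A s k P P' : perm_eq P P' -> fibre A s k P -> fibre A s k P'.
Proof.
move=> pP [uP sP hP]; split; first by rewrite -(perm_uniq pP).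
  by rewrite -(perm_size pP).
by move=> v; rewrite -(perm_mem pP) => /hP.
Qed.

Lemma fibre_rows A s k W c : c \notin A ++ s -> fibre A s k W ->
  fibre (c :: A) s (k * (size A + size s).+1) (flatten (map (row c) W)).
Proof.
move=> cA [uW <- hW].
have cW w : w \in W -> c \notin w by case/hW=> /perm_mem-> _.
split; first exact: uniq_rows.
  rewrite size_flatten /shape -map_comp -size_cat.
  elim: W hW {uW cW} => //= w W IH hW.
  rewrite IH => [|v vW]; last by apply: hW; rewrite inE vW orbT.
  by rewrite size_row (perm_size (hW w (mem_head _ _)).1) mulSn.
move=> v /flatten_mapP[w wW vw]; have [pw fw] := hW w wW; split.
  by rewrite (perm_trans (perm_row vw)) //= perm_cons.
rewrite -fw -(filter_row (cW w wW) vw) -filter_predI.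
by apply: eq_filter => x; rewrite /= !inE negb_or andbC.
Qed.

Lemma fibre_nil s : fibre [::] s 1 [:: s].
Proof.
split=> // v; rewrite inE => /eqP->; split=> //.
by apply/all_filterP/allP.
Qed.

Lemma fibre_perm_letters A A' s k P : perm_eq A A' -> fibre A s k P -> fibre A' s k P.
Proof.
move=> pA [uP sP hP]; split=> // v /hP[pv fv]; split.
  by rewrite (perm_trans pv) // perm_cat2r.
by rewrite -[RHS]fv; apply: eq_filter => x; rewrite /= (perm_mem pA).
Qed.

Lemma fibre_rev A s k P : fibre A s k P -> fibre A (rev s) k (map rev P).
Proof.
case=> uP sP hP; split; first by rewrite map_inj_uniq //; apply: can_inj revK.
  by rewrite size_map.
move=> _ /mapP[v /hP[pv fv] ->]; rewrite filter_rev fv; split=> //.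
rewrite perm_rev (perm_trans pv) // perm_cat2l perm_sym.
by rewrite perm_rev.
Qed.

(* The comb uses the columns from the second one on: there two rows are joined
   at their first elements only if the swap does not touch the first letter. *)
Definition stiff_adj (d : bool) (p q : seq nat) :=
  if d then adj p q else (head 0 p == head 0 q) && adj (behead p) (behead q).

Lemma stiff_adj_sym d : symmetric (stiff_adj d).
Proof. by case: d => p q; rewrite /stiff_adj adj_sym // eq_sym. Qed.

Lemma stiff_adjW d p q : stiff_adj d p q -> adj p q.
Proof.
case: d => //= /andP[]; case: p => [|x p]; case: q => [|y q] //=.
  by case: p.
by move=> -> ->.
Qed.

Lemma stiff_adj_cons d x p q : adj p q -> stiff_adj d (x :: p) (x :: q).
Proof. by case: d => [/adj_cons|] //= ->; rewrite eqxx. Qed.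

Lemma row_cons c w : row c w = (c :: w) :: behead (row c w).
Proof. by case: w. Qed.

(** Only the first link moves the first letter, and it carries the flag [true]; all later words
    begin with the first letter of [v]. *)
Lemma stiff_row b v : altsorted stiff_adj true (row b v).
Proof.
case: v => // x v.
have : altsorted stiff_adj false (map (cons x) (row b v)).
  apply: (@altsorted_map _ _ (fun=> adj)) => [d p q|].
    exact: stiff_adj_cons.
  by rewrite altsorted_const sorted_row.
by rewrite /= (row_cons b v) /= => ->; rewrite !eqxx orbT.
Qed.

(** * Insertion of two letters *)

Definition fibre2 b a s := zig true (map (row b) (row a s)).

(** The row of [w] begins with [c w] and ends with [w c], so rows of neighbouring words can be
    joined at either end. *)
Lemma altpath_rung_row c d w W : altpath (fun d u v => adj u v) d w W ->
  altpath (rung [::] (row c) (fun=> adj)) d w W.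
Proof.
elim: W d w => //= w' W IH d w /andP[ww' /IH->]; rewrite andbT /rung.
by case: d; rewrite ?last_row ?head_row ?adj_rcons ?adj_cons.
Qed.

Lemma sorted_zig_rows c d W : sorted adj W -> sorted adj (zig d (map (row c) W)).
Proof.
case: W => // w W sW; rewrite -(altsorted_const _ d).
apply: (altsorted_zig (x0 := [::])) => [v _|v _ d'|v _ d'|] //.
- by rewrite size_row.
- by rewrite altsorted_const; case: d'; rewrite ?sorted_rev_sym ?sorted_row //; apply: adj_sym.
by apply: altpath_rung_row; rewrite altpath_const.
Qed.

Section Fibre.
Variables (c b a : nat) (s : seq nat).
Hypotheses (odds : odd (size s)) (sa : a \notin s) (bas : b \notin a :: s)
  (cbas : c \notin b :: a :: s).

Lemma fibre2P : fibre [:: b; a] s ((size s).+1 * (size s).+2) (fibre2 b a s).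
Proof.
have := fibre_rows (A := [::]) sa (fibre_nil s); rewrite mul1n add0n => h1.
have := fibre_rows (A := [:: a]) bas h1; rewrite /= cats0 add1n.
by apply: fibre_perm; rewrite perm_sym /fibre2 perm_zig.
Qed.

(** As [size s] is odd, each row of [b] has the odd length [size s + 2], so flags and directions
    stay in phase: left joints have flag [false] and link words that both begin with [b]. *)
Lemma altsorted_fibre2 : altsorted stiff_adj true (fibre2 b a s).
Proof.
have := sorted_row a s; rewrite /fibre2 (row_cons a s) => srow.
have sz v : v \in row a s -> size v = (size s).+1.
  by move/perm_row/perm_size.
apply: (altsorted_zig (x0 := [::])); rewrite -?(row_cons a s).
- by move=> v _; rewrite size_row.
- move=> v /sz sv [|]; first exact: stiff_row.
  have := altsorted_rev stiff_adj_sym (stiff_row b v).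
  by rewrite size_row sv /= odds.
- by move=> v /sz sv d; rewrite size_row sv /= odds addbT.
move: srow; rewrite /= -(altpath_const _ true).
elim: (behead _) true (a :: s) => //= v R IH d u /andP[uv /IH->]; rewrite andbT /rung.
by case: d; rewrite ?last_row ?head_row ?stiff_adj_cons //= adj_rcons.
Qed.

Lemma sorted_fibre2 : sorted adj (fibre2 b a s).
Proof.
rewrite -(altsorted_const _ true) -[fibre2 _ _ _]map_id.
by apply: altsorted_map altsorted_fibre2 => d p q; apply: stiff_adjW.
Qed.

(** The number [size s + 1] of rows is even, so the last row is read backwards and ends with [b] in
    front. *)
Lemma fibre2E : exists R,
  fibre2 b a s = (b :: a :: s) :: (a :: b :: s) :: R
  /\ last (a :: b :: s) R = b :: rcons s a.
Proof.
have : last [::] (fibre2 b a s) = b :: rcons s a.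
  have eV : row a s = (a :: s) :: behead (row a s) by exact: row_cons.
  rewrite /fibre2 eV last_zig => [|v _]; last by rewrite size_row.
  rewrite size_behead size_row odds /= head_row.
  by have := last_row [::] a s; rewrite eV /= => ->.
rewrite /fibre2 (row_cons a s) /= (row_cons b s) /=.
set R := _ ++ _ => hR; exists R.
by split.
Qed.

End Fibre.

Lemma sorted_cat (T : Type) (e : rel T) x0 s t : 0 < size s -> 0 < size t ->
  sorted e (s ++ t) = [&& sorted e s, e (last x0 s) (head x0 t) & sorted e t].
Proof.
by move=> s0 t0; rewrite -!(altsorted_const e true) (altsorted_cat x0) // !altsorted_const.
Qed.

Lemma last_cat_nonempty (T : Type) (x0 : T) s t : 0 < size t -> last x0 (s ++ t) = last x0 t.
Proof. by rewrite last_cat; case: t. Qed.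

Lemma head_cat_nonempty (T : Type) (x0 : T) s t : 0 < size s -> head x0 (s ++ t) = head x0 s.
Proof. by case: s. Qed.

(** * Hamiltonian paths between corners of a three-letter fibre *)

Definition corner (K : seq nat * seq nat) (s : seq nat) := K.1 ++ s ++ K.2.

(** This is $(m+3)!/m!$. *)
Definition fibre_size m := m.+1 * m.+2 * m.+3.

Definition traverses A s K K' P :=
  [/\ fibre A s (fibre_size (size s)) P, sorted adj P,
      head [::] P = corner K s & last [::] P = corner K' s].

Section Traversals.
Variables (c b a : nat) (s : seq nat).
Hypotheses (odds : odd (size s)) (sa : a \notin s) (bas : b \notin a :: s)
  (cbas : c \notin b :: a :: s).

Let rows_fibre :
  fibre [:: c; b; a] s (fibre_size (size s)) (flatten (map (row c) (fibre2 b a s))).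
Proof. exact: (fibre_rows (A := [:: b; a]) cbas (fibre2P sa bas)). Qed.

Lemma odd_size_behead_fibre2 x y R : fibre2 b a s = x :: y :: R -> odd (size R) = false.
Proof.
move=> e; have [_ + _] := fibre2P sa bas; rewrite e => /(congr1 odd).
by rewrite oddM /= negbK andbN.
Qed.

(** The rows of [c] are even in number, so the last one runs opposite to the first: the path both
    starts and ends with [c] in front. In [traverses_zig_left] all directions are exchanged and [c]
    is at the end both times. *)
Lemma traverses_zig_right :
  traverses [:: c; b; a] s ([:: c; b; a], [::]) ([:: c; b], [:: a])
    (zig true (map (row c) (fibre2 b a s))).
Proof.
split.
- by apply: fibre_perm rows_fibre; rewrite perm_sym perm_zig.
- exact/sorted_zig_rows/sorted_fibre2.
- by have [R [-> _]] := fibre2E b a odds; rewrite /corner /= cats0.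
have [R [e lR]] := fibre2E b a odds.
rewrite e last_zig /= => [|v _]; last by rewrite size_row.
by rewrite (odd_size_behead_fibre2 e) /= head_row lR /corner /= cats1.
Qed.

Lemma traverses_zig_left :
  traverses [:: c; b; a] s ([:: b; a], [:: c]) ([:: b], [:: a; c])
    (zig false (map (row c) (fibre2 b a s))).
Proof.
split.
- by apply: fibre_perm rows_fibre; rewrite perm_sym perm_zig.
- exact/sorted_zig_rows/sorted_fibre2.
- have [R [-> _]] := fibre2E b a odds; rewrite head_zig ?size_row //.
  by rewrite last_row /corner /= cats1.
have [R [e lR]] := fibre2E b a odds.
rewrite e last_zig => [|v _]; last by rewrite size_row.
rewrite /= (odd_size_behead_fibre2 e) /= last_row lR /corner /=.
by rewrite -cats1 -cats1 -catA.
Qed.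

(** The first row is read backwards, then the column with [c] in front is followed through the
    remaining words, and the other columns are filled by a zigzag on the way back. For [W] of even
    length this ends right beside the start, a Hamiltonian cycle lacking its closing edge. *)
Definition comb W :=
  if W is w :: W' then
    rev (row c w) ++ map (cons c) W' ++ zig true (map (behead \o row c) (rev W'))
  else [::].

Lemma perm_comb W : perm_eq (comb W) (flatten (map (row c) W)).
Proof.
case: W => //= w W; apply: perm_cat; first by rewrite perm_rev.
apply: (@perm_trans _ (map (cons c) W ++ flatten (map (behead \o row c) W))).
  rewrite perm_cat2l; apply: (perm_trans (perm_zig _ _)).
  by apply: perm_flatten; rewrite perm_map // perm_rev.
elim: W => //= v W IH; rewrite (row_cons c v) /= perm_cons.
by rewrite perm_catCA perm_cat2l.
Qed.

Lemma stiff_rung d u v : stiff_adj d u v -> rung [::] (behead \o row c) (fun=> adj) d u v.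
Proof.
have tail x w : behead (row c (x :: w)) = map (cons x) (row c w) by [].
have lastE z w : last [::] (map (cons z) (row c w)) = rcons (z :: w) c.
  by have := last_row [::] c w; rewrite (row_cons c w) /= last_map => ->.
case: u => [|x u]; first by case: d => //= /andP[].
case: v => [|y v]; first by case: d => //= /andP[_]; case: u.
case: d; rewrite /rung /comp !tail; first by rewrite !lastE; apply: adj_rcons.
by case/andP=> /eqP /= <- uv; rewrite (row_cons c u) (row_cons c v); do 2!apply: adj_cons.
Qed.

Lemma traverses_comb :
  traverses [:: c; b; a] s ([:: b; a], [:: c]) ([:: a; b], [:: c])
    (comb (fibre2 b a s)).
Proof.
have [R [e lR]] := fibre2E b a odds.
have alt := altsorted_fibre2 b a odds.
have ne : {in fibre2 b a s, forall v, 0 < size v}.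
  by move=> v; have [_ _ h] := fibre2P sa bas; move/h=> [/perm_size->].
have odd2 := odd_size_behead_fibre2 e.
set W' := (a :: b :: s) :: R in e.
have neW' : {in rev W', forall v, 0 < size (behead (row c v))}.
  move=> v; rewrite mem_rev => vW; rewrite size_behead size_row ne // e.
  by rewrite in_cons vW orbT.
have eW' : rev W' = last (a :: b :: s) R :: rev (belast (a :: b :: s) R).
  exact: rev_lastI.
set Z := zig true (map (behead \o row c) (rev W')).
have Z0 : 0 < size Z by rewrite /Z eW' size_zig //= neW' // eW' mem_head.
have hZ : head [::] Z = b :: c :: rcons s a.
  rewrite /Z eW' head_zig /= ?neW' ?eW' ?mem_head // lR.
  by rewrite /= row_cons.
(* The zigzag has an odd number of rows, so its last row runs forwards. *)
have lZ : last [::] Z = rcons (a :: b :: s) c.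
  rewrite /Z eW' last_zig; last by rewrite -eW'.
  rewrite size_rev size_belast odd2 /=.
  have := last_rev_belast (a :: b :: s) R [::]; rewrite -/W' eW' /= => ->.
  by have := last_row [::] c (a :: b :: s); rewrite row_cons.
have sZ : sorted adj Z.
  rewrite -(altsorted_const _ true) /Z eW'.
  apply: (altsorted_zig (x0 := [::])); rewrite -?eW'.
  - exact: neW'.
  - move=> v _ d; rewrite altsorted_const.
    have : sorted adj (behead (row c v)).
      by have := sorted_row c v; rewrite row_cons /=; apply: path_sorted.
    by case: d; rewrite ?sorted_rev_sym //; apply: adj_sym.
  - by [].
  suff : altsorted (rung [::] (behead \o row c) (fun=> adj)) true (rev W').
    by rewrite eW'.
  rewrite -[rev W']map_id; apply: altsorted_map (stiff_rung) _.
  (* Without its first word the path starts with flag [false]; as [W'] has odd length, its reversal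
     starts with [true], the initial direction of [Z]. *)
  move: alt; rewrite e => /andP[_ alt].
  have := @altsorted_rev _ stiff_adj false W' stiff_adj_sym alt.
  by rewrite /= odd2.
have eC : comb (fibre2 b a s) = rev (row c (b :: a :: s)) ++ map (cons c) W' ++ Z.
  by rewrite e.
split.
- by apply: fibre_perm rows_fibre; rewrite perm_sym perm_comb.
- rewrite eC (sorted_cat _ [::]) ?size_rev ?size_row //.
  rewrite sorted_rev_sym ?sorted_row; last exact: adj_sym.
  rewrite last_rev head_row /= !eqxx orbT /=.
  have := @sorted_cat _ adj [::] (map (cons c) W') Z.
  rewrite /= => -> //; rewrite sZ andbT hZ.
  rewrite last_map lR /= !eqxx /= orbT andbT.
  have := sorted_fibre2 b a odds; rewrite e => /path_sorted.
  exact: (homo_sorted_map (@adj_cons c)).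
- rewrite eC head_cat_nonempty ?size_rev ?size_row //.
  by rewrite head_rev last_row /corner /= cats1.
rewrite eC catA last_cat_nonempty // lZ /corner /=.
by rewrite cats1.
Qed.

End Traversals.

(** * Symmetries of traversals *)

Definition mirror (K : seq nat * seq nat) := (rev K.2, rev K.1).

Lemma corner_mirror K s : corner (mirror K) s = rev (corner K (rev s)).
Proof. by rewrite /corner /= !rev_cat revK catA. Qed.

Lemma traverses_rev A s K K' P : traverses A s K K' P -> traverses A s K' K (rev P).
Proof.
case=> fP sP hP lP; split; rewrite ?head_rev ?last_rev //.
  by apply: fibre_perm fP; rewrite perm_sym perm_rev.
by rewrite sorted_rev_sym //; apply: adj_sym.
Qed.

Lemma traverses_mirror A s K K' P : traverses A s K K' P ->
  traverses A (rev s) (mirror K) (mirror K') (map rev P).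
Proof.
case=> fP sP hP lP; rewrite /traverses !corner_mirror !revK -hP -lP size_rev.
case: P fP sP {hP lP} => [[]//|p P] fP sP; split=> //.
- exact: fibre_rev fP.
- exact: homo_sorted_map adj_rev sP.
- by rewrite /= last_map.
Qed.

Lemma traverses_perm_letters A A' s K K' P :
  perm_eq A A' -> traverses A s K K' P -> traverses A' s K K' P.
Proof. by move=> pA [fP *]; split=> //; apply: fibre_perm_letters fP. Qed.

(** * Walks of corners and the paths they induce *)

Section Walks.
Variables A g : seq nat.

(** Quantifying over all arrangements of [g] lets any step be used in any fibre, and makes steps
    stable under [mirror], which replaces [s] by its reversal. *)
Definition step K K' := forall s, perm_eq s g -> exists P, traverses A s K K' P.

Lemma step_sym K K' : step K K' -> step K' K.
Proof. by move=> h s /h[P tP]; exists (rev P); apply: traverses_rev. Qed.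

Lemma step_mirror K K' : step K K' -> step (mirror K) (mirror K').
Proof.
move=> h s sg; have [|P tP] := h (rev s); first by rewrite perm_rev.
by exists (map rev P); rewrite -[s]revK; apply: traverses_mirror.
Qed.

Inductive walk : nat -> seq nat * seq nat -> seq nat * seq nat -> Prop :=
| walk_nil K : walk 0 K K
| walk_cons k K K' K'' : step K K' -> walk k K' K'' -> walk k.+1 K K''.

Lemma walk_back_and_forth j k K K' K'' :
  step K K' -> walk k K K'' -> walk (j.*2 + k) K K''.
Proof.
move=> h w; elim: j => //= j IH.
exact: walk_cons h (walk_cons (step_sym h) IH).
Qed.

Definition spans S K K' H :=
  [/\ uniq H, size H = size S * fibre_size (size g), sorted adj H,
      head [::] H = corner K (head [::] S) /\ last [::] H = corner K' (last [::] S)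
    & {in H, forall v, perm_eq v (A ++ g) /\ filter (predC (mem A)) v \in S}].

Lemma spans1 s K K' P : perm_eq s g -> traverses A s K K' P -> spans [:: s] K K' P.
Proof.
move=> sg [[uP sP hP] aP eh el]; split; rewrite ?mul1n -?(perm_size sg) //.
by move=> v /hP[pv ->]; rewrite inE eqxx (perm_trans pv) // perm_cat2l.
Qed.

Lemma adj_corner K p q : adj p q -> adj (corner K p) (corner K q).
Proof. exact: adj_cat. Qed.

(** Passing to the next fibre keeps the corner [K1], so the joining link is the given transposition
    inside the contiguous word [s]. *)
Lemma spans_cons s S K K1 K' P H : perm_eq s g -> s \notin S -> path adj s S ->
  0 < size S -> traverses A s K K1 P -> spans S K1 K' H ->
  spans (s :: S) K K' (P ++ H).
Proof.
move=> sg sS aS S0 tP [uH sH aH [hH lH] mH].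
have [uP sP aP [hP lP] mP] := spans1 sg tP.
have P0 : 0 < size P by rewrite sP.
have H0 : 0 < size H by rewrite sH /fibre_size !muln_gt0 S0.
split.
- rewrite cat_uniq uP uH andbT /=; apply/hasPn=> v /mH[_ vS]; apply: contra sS.
  by case/mP=> _; rewrite inE => /eqP<-.
- by rewrite size_cat sP sH mul1n mulSn.
- rewrite (sorted_cat _ [::]) // aP aH lP hH adj_corner //.
  by case: S aS S0 {sS sH mH hH lH} => //= ? ? /andP[].
- rewrite head_cat_nonempty // last_cat_nonempty // hP lH.
  by split=> //; case: S S0 {sS aS sH mH hH lH}.
move=> v; rewrite mem_cat => /orP[/mP|/mH] [-> ?]; split=> //.
  by rewrite inE -mem_seq1; apply/orP; left.
by rewrite inE; apply/orP; right.
Qed.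

Lemma walk_spans s S K K' : path adj s S -> uniq (s :: S) ->
  all (perm_eq^~ g) (s :: S) -> walk (size S).+1 K K' ->
  exists H, spans (s :: S) K K' H.
Proof.
elim: S s K => [|t S IH] s K.
  move=> _ _ /= /andP[sg _] w; inversion w as [|k K1 K2 K3 h w']; subst.
  inversion w'; subst; have [P tP] := h s sg.
  by exists P; apply: spans1.
move=> aS /andP[sS uS] /andP[sg gS] w; inversion w as [|k K1 K2 K3 h w']; subst.
have /andP[_ at_] := aS; have [H sH] := IH t K2 at_ uS gS w'.
have [P tP] := h s sg.
by exists (P ++ H); apply: spans_cons tP sH.
Qed.

Hypotheses (uA : uniq A) (oddg : odd (size g)) (gA : {in g, forall x, x \notin A}).

Lemma letters_fresh x y z s : perm_eq [:: x; y; z] A -> perm_eq s g ->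
  [/\ odd (size s), z \notin s, y \notin z :: s & x \notin y :: z :: s].
Proof.
move=> pA sg; rewrite (perm_size sg) oddg.
have out t : t \in A -> t \notin s.
  by move=> tA; rewrite (perm_mem sg); apply/negP=> /gA; rewrite tA.
have := uA; rewrite -(perm_uniq pA) /= !inE !negb_or => /and3P[/andP[xy xz] yz _].
by split; rewrite // ?inE ?negb_or ?xy ?xz ?yz ?out // -(perm_mem pA) !inE eqxx ?orbT.
Qed.

Lemma step_out x y z : perm_eq [:: x; y; z] A ->
  step ([:: x; y; z], [::]) ([:: x; y], [:: z]).
Proof.
move=> pA s sg; have [h1 h2 h3 h4] := letters_fresh pA sg.
exists (zig true (map (row x) (fibre2 y z s))).
by apply: traverses_perm_letters pA _; apply: traverses_zig_right.
Qed.

Lemma step_across x y z : perm_eq [:: x; y; z] A ->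
  step ([:: x; y], [:: z]) ([:: x], [:: y; z]).
Proof.
move=> pA s sg.
have pA' : perm_eq [:: z; x; y] A by rewrite -(perm_rot 2) in pA.
have [h1 h2 h3 h4] := letters_fresh pA' sg.
exists (zig false (map (row z) (fibre2 x y s))).
by apply: traverses_perm_letters pA' _; apply: traverses_zig_left.
Qed.

Lemma step_swap x y z : perm_eq [:: x; y; z] A ->
  step ([:: x; y], [:: z]) ([:: y; x], [:: z]).
Proof.
move=> pA s sg.
have pA' : perm_eq [:: z; x; y] A by rewrite -(perm_rot 2) in pA.
have [h1 h2 h3 h4] := letters_fresh pA' sg.
exists (comb z (fibre2 x y s)).
by apply: traverses_perm_letters pA' _; apply: traverses_comb.
Qed.

(** The initial move from [xyz|] to [xy|z] is left out: the path in the first fibre has to stay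
    explicit for property $P$. *)
Lemma walk_to_mirror x y z j : perm_eq [:: x; y; z] A ->
  walk (j.*2 + 7) ([:: x; y], [:: z]) ([::], [:: z; y; x]).
Proof.
move=> pA.
have perms l : perm_eq l [:: x; y; z] -> perm_eq l A by move/perm_trans; apply.
have pyxz : perm_eq [:: y; x; z] A by apply: perms; rewrite (perm_catCA [:: y] [:: x]).
have pzxy : perm_eq [:: z; x; y] A by apply: perms; rewrite -(perm_rot 1).
have pyzx : perm_eq [:: y; z; x] A by apply: perms; rewrite perm_sym -(perm_rot 1).
have pzyx : perm_eq [:: z; y; x] A
  by apply: perms; rewrite -[[:: z; y; x]]/(rev [:: x; y; z]) perm_rev.
have swap := step_swap pA.
apply: (walk_back_and_forth _ swap).
apply: (walk_cons swap).
apply: (walk_cons (step_across pyxz)).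
apply: (walk_cons (step_mirror (step_swap pzxy))).
apply: (walk_cons (step_sym (step_across pyzx))).
apply: (walk_cons (step_swap pyzx)).
apply: (walk_cons (step_across pzyx)).
apply: (walk_cons (step_sym (step_mirror (step_out pA)))).
exact: walk_nil.
Qed.

End Walks.

(** * Assembly of the code *)

Lemma half_code_relabel m L : 1 < m -> reverse_gray_code m L ->
  exists T, [/\ size T = m`! %/ 2, uniq (T ++ map rev T),
    all (perm_eq^~ (iota 3 m)) T, sorted adj (T ++ map rev T)
    & head [::] T = iota 3 m].
Proof.
move=> m1 [sL uL pL aL rL].
have m2 : m`! = m`! %/ 2 + m`! %/ 2.
  by rewrite addnn -muln2 divnK // dvdn_fact.
have h0 : 0 < m`! %/ 2 by have := fact_gt0 m; rewrite {1}m2; lia.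
set h := m`! %/ 2 in m2 h0 rL *.
pose w0 := nth [::] L 0.
have pnth i : i < m`! -> perm_eq (nth [::] L i) (iota 1 m).
  by rewrite -sL => /(mem_nth [::]) /(allP pL).
have pw0 : perm_eq w0 (iota 1 m) by apply: pnth; rewrite fact_gt0.
have uw0 : uniq w0 by rewrite (perm_uniq pw0) iota_uniq.
have sw0 : size w0 = m by rewrite (perm_size pw0) size_iota.
(* Sending each letter to its position in the first word, shifted by 3, turns that word into
   [iota 3 m] and leaves the letters 1 and 2 free. *)
pose f v := 3 + index v w0.
have fw0 : map f w0 = iota 3 m.
  apply: (@eq_from_nth _ 0) => [|i]; rewrite size_map sw0 ?size_iota // => im.
  by rewrite (nth_map 0) ?sw0 // /f index_uniq ?sw0 // nth_iota.
have fK w : perm_eq w (iota 1 m) -> map (fun k => nth 0 w0 (k - 3)) (map f w) = w.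
  move=> pw; rewrite -map_comp; apply: map_id_in => v vw /=.
  by rewrite /f addKn nth_index // (perm_mem pw0) -(perm_mem pw).
have finj : {in L &, injective (map f)}.
  move=> v w /(allP pL) /fK {2}<- /(allP pL) /fK {2}<- -> //.
have eL : L = take h L ++ map rev (take h L).
  rewrite -{1}[L](cat_take_drop h); congr (_ ++ _).
  have szt : size (take h L) = h by rewrite size_take sL m2; case: ltnP => //; lia.
  apply: (@eq_from_nth _ [::]) => [|i].
    by rewrite size_map szt size_drop sL m2 addnK.
  rewrite size_drop sL m2 addnK => ih.
  by rewrite nth_drop (nth_map [::]) ?szt // nth_take // addnC rL.
exists (map (map f) (take h L)).
have <- : map (map f) L
    = map (map f) (take h L) ++ map rev (map (map f) (take h L)).
  rewrite {1}eL map_cat -!map_comp; congr (_ ++ _).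
  by apply: eq_map => w /=; rewrite map_rev.
split.
- by rewrite size_map size_take sL m2; case: ltnP => //; lia.
- by rewrite map_inj_in_uniq.
- apply/allP=> _ /mapP[w /mem_take wL ->] /=; rewrite -fw0 perm_map //.
  by rewrite (perm_trans (allP pL _ wL)) // perm_sym.
- apply: (homo_sorted_map (@adj_map f)); apply/(sortedP [::]) => i iL.
  exact/adj_transpP/aL.
have take_cons k (M : seq (seq nat)) : 0 < k -> 0 < size M ->
  take k M = nth [::] M 0 :: behead (take k M) by case: k M => [|k] [|w M].
by rewrite take_cons ?sL ?fact_gt0.
Qed.

Lemma reverse_gray_code_double n Q : 1 < n -> size Q = n`! %/ 2 ->
  uniq (Q ++ map rev Q) -> all (perm_eq^~ (iota 1 n)) Q ->
  sorted adj (Q ++ map rev Q) -> reverse_gray_code n (Q ++ map rev Q).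
Proof.
move=> n1 sQ uQ pQ aQ.
have sz : size (Q ++ map rev Q) = n`!.
  by rewrite size_cat size_map sQ addnn -muln2 divnK // dvdn_fact.
split=> //.
- rewrite all_cat pQ; apply/allP=> _ /mapP[w wQ ->].
  by rewrite /= perm_rev (allP pQ).
- by move=> i iQ; apply/adj_transpP; move/(sortedP [::]): aQ; apply.
by move=> i ilt; rewrite -sQ in ilt *; rewrite !nth_cat ilt ltnNge leq_addl /= addnK (nth_map [::]).
Qed.

(** The sequence [X], [Y] followed by its mirror image is a closed cycle; here it is cut open
    between [X] and [Y]. *)
Lemma sorted_double X Y : 0 < size X -> 0 < size Y -> sorted adj (X ++ Y) ->
  adj (last [::] Y) (rev (head [::] X)) ->
  sorted adj ((Y ++ map rev X) ++ map rev (Y ++ map rev X)).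
Proof.
move=> X0 Y0; rewrite (sorted_cat _ [::]) // => /and3P[aX XY aY] YX.
have aR Z : sorted adj Z -> sorted adj (map rev Z).
  by apply: homo_sorted_map; apply: adj_rev.
have hd Z : 0 < size Z -> head [::] (map rev Z) = rev (head [::] Z) by case: Z.
have lst Z : 0 < size Z -> last [::] (map rev Z) = rev (last [::] Z).
  by case: Z => //= z Z _; rewrite last_map.
rewrite map_cat (mapK revK) -!catA.
rewrite !(sorted_cat _ [::]) ?size_cat ?size_map ?addn_gt0 ?X0 ?Y0 //.
rewrite !head_cat_nonempty ?size_map // !hd // !lst // aY YX !aR //= aX andbT.
by rewrite adj_rev //; have := adj_rev YX; rewrite revK.
Qed.

Lemma half_fact m : 4 < m -> exists j, m`! %/ 2 = (j.*2 + 7).+1.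
Proof.
move=> m4; have h60 : 120 %| m`!.
  rewrite -(subnKC m4) -[120]/(5`!).
  by elim: (m - 5) => [|k IH]; rewrite ?addn0 // addnS factS dvdn_mull.
have m0 := fact_gt0 m; case/dvdnP: h60 m0 => q ->; rewrite muln_gt0 => /andP[q0 _].
(* With [m! = 120 q] the equation reads [60 q = 2 j + 8]. *)
by exists (q * 30 - 4); rewrite (_ : q * 120 = (q * 60) * 2) ?mulnK; lia.
Qed.

Lemma rev_insert_at k c w : k <= size w ->
  rev (insert_at k c w) = insert_at (size w - k) c (rev w).
Proof.
move=> kw; rewrite /insert_at rev_cat rev_cons -cats1 -catA.
by rewrite take_rev drop_rev subKn.
Qed.

Lemma iota_extremes m : iota 1 (m + 3) = [:: 1; 2] ++ iota 3 m ++ [:: m + 3].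
Proof. by rewrite (addnC m) -[iota 1 _]/(1 :: 2 :: iota 3 m.+1) -(addn1 m) iotaD. Qed.

Lemma half_code m : odd m -> 4 < m ->
  (exists L, reverse_gray_code m L) ->
  exists X Y, [/\ X = row (m + 3) (2 :: 1 :: iota 3 m),
    size (X ++ Y) = (m + 3)`! %/ 2 /\ uniq ((X ++ Y) ++ map rev (X ++ Y)),
    all (perm_eq^~ (iota 1 (m + 3))) (X ++ Y), sorted adj (X ++ Y)
    & adj (last [::] Y) (rev (head [::] X)) /\ head [::] Y = iota 1 (m + 3)].
Proof.
move=> om m4 [L rgL]; have [T [sT uT pT aT hT]] := half_code_relabel (ltnW (ltnW (ltnW m4))) rgL.
set g := iota 3 m; set n := m + 3.
have [j hj] := half_fact m4.
have sg : size g = m by rewrite size_iota.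
pose A := [:: n; 2; 1].
have gA : {in g, forall x, x \notin A}.
  by move=> x; rewrite mem_iota !inE !negb_or; lia.
have uA : uniq A by rewrite /= !inE; lia.
have og : odd (size g) by rewrite sg.
have [h1 h2 h3 h4] := letters_fresh uA og gA (perm_refl _) (perm_refl g).
have out := traverses_zig_right h1 h2 h3 h4.
have [R [eR _]] := fibre2E 2 1 og.
case: T sT uT pT aT hT => [|t0 [|t1 T]]; rewrite ?hj; [by []|by move=> /= []; lia|].
move=> [sT] uT pT aT /= t0g; rewrite {t0}t0g in uT pT aT.
have w := walk_to_mirror uA og gA j (perm_refl A).
have [pg pT'] : perm_eq g g /\ all (perm_eq^~ g) (t1 :: T) by case/andP: pT.
have aT' : path adj g (t1 :: T) by move: aT; rewrite /= cat_path => /and3P[-> ->].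
have [gT uT'] : g \notin t1 :: T /\ uniq (t1 :: T).
  by move: uT; rewrite cat_uniq => /andP[/= /andP[]].
rewrite -sT in w; have [|H spH] := walk_spans _ uT' pT' w; first by case/andP: aT'.
have [uH sH aH [hH lH] mH] := spans_cons pg gT aT' isT out spH.
(* [X] is the first row of the first fibre and [Y0] the rest of that fibre, whose first row is read
   backwards and so begins with [1 2 g n], the identity word. *)
set X := row n (2 :: 1 :: g).
set Y0 := zig false (map (row n) ((1 :: 2 :: g) :: R)).
rewrite (_ : zig _ _ = X ++ Y0) ?eR // -catA in uH sH aH hH lH mH.
have Y0gt0 : 0 < size Y0 by apply: size_zig; rewrite size_row.
exists X, (Y0 ++ H); split.
- by [].
- split.
    have -> : n`! = m`! %/ 2 * fibre_size m * 2.
      rewrite mulnAC divnK ?dvdn_fact ?(ltnW (ltnW (ltnW m4))) //.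
      by rewrite /n addn3 !factS [RHS]mulnC /fibre_size [_ * m.+3]mulnC [_ * m.+2]mulnC !mulnA.
    by rewrite mulnK // sH sg hj /= sT.
  rewrite cat_uniq uH map_inj_uniq ?uH ?andbT; last exact: can_inj revK.
  (* If a word and its reversal both lay on the path, deleting [n], 2, 1 would give a word common to
     the half code and its mirror image. *)
  apply/hasPn=> _ /mapP[u /mH[_ uT0] ->]; apply/negP=> /mH[_].
  rewrite filter_rev => ruT0; move: uT; rewrite cat_uniq => /and3P[_ /hasPn + _].
  by move/(_ _ (map_f rev uT0)); rewrite /= ruT0.
- apply/allP=> v /mH[pv _]; rewrite /= (perm_trans pv) // iota_extremes.
  apply: (@perm_trans _ ([:: 1; 2] ++ [:: n] ++ g)).
    by rewrite catA perm_cat2r -[[:: n; 2; 1]]/(rev [:: 1; 2; n]) perm_rev.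
  by rewrite perm_cat2l perm_catC.
- by [].
rewrite head_cat_nonempty // head_zig ?size_row // last_row iota_extremes cats1.
split; last by [].
have H0 : 0 < size H by case: spH => _ ->.
rewrite last_cat_nonempty //; move: lH; rewrite catA last_cat_nonempty // => ->.
(* The path ends at a corner mirroring the one it starts from, so closing it up reduces to the link
   from the half code to its mirror image. *)
rewrite head_row -[n :: 2 :: _](cats0 ([:: n; 2; 1] ++ g)) -catA.
rewrite -[_ ++ g ++ [::]]/(corner ([:: n; 2; 1], [::]) g).
rewrite -[X in rev (corner _ X)]revK -corner_mirror.
apply: adj_corner; move: aT.
rewrite (sorted_cat _ [::]) ?size_map // => /and3P[_ + _]; exact.
Qed.

Theorem theorem8 (n : nat) :
  n %% 4 = 0 -> 8 <= n ->
  (exists L, reverse_gray_code (n - 3) L) ->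
  exists L, reverse_gray_code n L /\ propP n L.
Proof.
move=> n4 n8; have [m n_m] : exists m, n = m + 3 by exists (n - 3); lia.
subst n; rewrite addnK => rgc.
have om : odd m by lia.
have m4 : 4 < m by lia.
have [X [Y [eX [sXY uXY] pXY aXY [aYX hY]]]] := half_code om m4 rgc.
set n := m + 3 in n4 n8 eX sXY pXY hY *.
have sX : size X = n by rewrite eX size_row /= size_iota /n; lia.
have Y0 : 0 < size Y.
  by case: Y hY {sXY uXY pXY aXY aYX} => // /(congr1 size); rewrite size_iota /n /=; lia.
pose Q := Y ++ map rev X.
have sQ : size Q = n`! %/ 2 by rewrite -sXY !size_cat size_map addnC.
exists (Q ++ map rev Q); split.
  apply: reverse_gray_code_double => //.
  - by apply: leq_trans n8.
  - rewrite -(perm_uniq (s1 := (X ++ Y) ++ map rev (X ++ Y))) //.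
    apply/permP=> p; rewrite /Q !map_cat (mapK revK) !count_cat.
    by rewrite [RHS](AC (2*2) ((4*1)*(2*3))).
  - move: pXY; rewrite !all_cat => /andP[pX ->]; apply/allP=> _ /mapP[w wX ->].
    by rewrite /= perm_rev (allP pX).
  by apply: sorted_double; rewrite // sX /n addn3.
(* [Q] ends with the reversals of the words of [X], in the order of [X]. There [n] moves rightwards
   through [2 1 3 ... n-1], hence leftwards through the base word after reversal. *)
have nthQ j : 0 < j <= 4 -> nth [::] (Q ++ map rev Q) (n`! %/ 2 - j)
    = insert_at j.-1 n (base_word n).
  case/andP=> j0 j4; rewrite -sQ nth_cat.
  have jX : j <= size X by rewrite sX; lia.
  have Q0 : 0 < size Q by rewrite size_cat ltn_addr.
  rewrite ltn_subrL j0 Q0 /= /Q size_cat size_map.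
  have -> : size Y + size X - j = size Y + (n - j) by rewrite -sX; lia.
  rewrite nth_cat ltnNge leq_addr /= addKn.
  have nj : n - j < n by lia.
  rewrite (nth_map [::]) ?sX // eX nth_row; last by rewrite /= size_iota /n; lia.
  rewrite rev_insert_at; last by rewrite /= size_iota /n; lia.
  rewrite /= size_iota !rev_cons -!cats1 -catA /base_word addnK.
  by congr insert_at; rewrite /n; lia.
split; rewrite ?nthQ //.
by rewrite -hY -nth0 !nth_cat Y0 size_cat ltn_addr.
Qed.
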